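(* Let $\tau:[0,\infty)\to[0,\infty)$ be continuous with $\lim_{t\to\infty}\{t-\tau(t)\}=\infty$, let $-\bar{\tau}=\inf_{t\ge 0}\{t-\tau(t)\}$, and suppose $\lim_{t\to\infty}\tau(t)/t=q$ for some $q\in(0,1)$. Let $g:[0,\infty)\to[0,\infty)$ be continuous with $g(0)=0$, $g(x)>0$ for $x>0$, such that there is $\delta_1>0$ with $g\in C^1(0,\delta_1)$ and $g'(x)>0$ for $x\in(0,\delta_1)$, and there is $\beta>1$ with $g'\in\mathrm{RV}_0(\beta-1)$. Let $a>b>0$ obey $$a<b\left(\frac{1}{1-q}\right)^{\beta/(\beta-1)}.$$ Let $\psi\in C([-\bar\tau,0];(0,\infty))$. If the solution $x$ of $$x'(t)=-ag(x(t))+b\max_{t-\tau(t)\le s\le t}g(x(s)),\quad t\ge 0;\qquad x(t)=\psi(t),\quad t\in[-\bar\tau,0],$$ obeys $x(t)\to0$ as $t\to\infty$, then $$\lim_{t\to\infty}\frac{\log x(t)}{\log t}=-\frac1\beta\,\frac{1}{\log(1/(1-q))}\log\left(\frac ab\right).$$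
   Context: A function $f$, positive near $0$ on the right, is regularly varying at zero with exponent $\alpha\in\mathbb{R}$, written $f\in\mathrm{RV}_0(\alpha)$, if $\lim_{t\to0^+}f(\lambda t)/f(t)=\lambda^\alpha$ for all $\lambda>0$. A solution of the equation is a continuous function $x:[-\bar\tau,\infty)\to(0,\infty)$, differentiable on $[0,\infty)$ (one-sided at $0$), satisfying the equation for all $t\ge0$ and equal to $\psi$ on $[-\bar\tau,0]$; solutions are positive. *)

(* Defs.v *)
(* Functions on a half-line or an interval of [R] are total functions [R -> R]
   constrained only on their domain. *)
From HB Require Import structures.
From mathcomp Require Import all_boot all_order all_algebra.
From mathcomp Require Import all_classical all_reals all_analysis.

Set Implicit Arguments.
Unset Strict Implicit.
Unset Printing Implicit Defensive.

Import Order.TTheory GRing.Theory Num.Theory.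
Import numFieldNormedType.Exports.

Local Open Scope classical_set_scope.
Local Open Scope ring_scope.

Definition regularly_varying0 (R : realType) (alpha : R) (f : R -> R) : Prop :=
  (\forall t \near 0^'+, 0 < f t) /\
  (forall lambda : R, 0 < lambda ->
     f (lambda * t) / f t @[t --> 0^'+] --> lambda `^ alpha).

Definition is_maximum (R : realType) (A : set R) (m : R) : Prop :=
  A m /\ ubound A m.

(* The derivative of a function on [0, +oo[ : two-sided at t > 0, and the right
   derivative at t = 0, where values at negative arguments play no role. *)
Definition is_derive_ray (R : realType) (x : R -> R) (t v : R) : Prop :=
  (0 < t -> is_derive t 1 x v) /\
  (t = 0 -> (x h - x 0) / h @[h --> 0^'+] --> v).

Definition is_solution (R : realType) (tau g : R -> R) (a b taubar : R)
    (psi x : R -> R) : Prop :=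
  [/\ {within `[- taubar, +oo[, continuous x},
      forall t : R, - taubar <= t -> 0 < x t,
      forall t : R, 0 <= t ->
        exists2 m, is_maximum [set g (x s) | s in `[t - tau t, t]] m &
                   is_derive_ray x t (- a * g (x t) + b * m) &
      forall t : R, - taubar <= t <= 0 -> x t = psi t].

(* Main.v *)
Require Import Defs.
From HB Require Import structures.
From mathcomp Require Import all_boot all_order all_algebra.
From mathcomp Require Import all_classical all_reals all_analysis.
From mathcomp Require Import ring lra.

Set Implicit Arguments.
Unset Strict Implicit.
Unset Printing Implicit Defensive.

Import Order.TTheory GRing.Theory Num.Theory.
Import numFieldNormedType.Exports.

Local Open Scope classical_set_scope.
Local Open Scope ring_scope.

(** With [y = x t] small, the equation nearly forces the balance
    [a * g (x t) = b * g (x (t - tau t))]: [g] is increasing and regularly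
    varying with exponent [beta] at zero, and [t - tau t] is about
    [(1 - q) * t], so a power [x t = t ^ (- G)] satisfies it to leading order exactly
    when [a / b = (1 - q) ^ (- beta * G)], that is when [- G] is the limit in
    the theorem.  The term [x'] is of order [t ^ (- G - 1)], and the bound on
    [a / b] says [(beta - 1) * G < 1], i.e. that [x'] is small compared with
    [g (x t)], which is roughly of order [t ^ (- beta * G)].

    Both bounds come from a maximum principle for [h = ln x + r * ln] and for
    its opposite.  A function whose derivative is negative at each late record,
    a time at which it is at its maximum so far, is bounded above
    ([bounded_of_records]).
    At a record of [ln x + r * ln] with [r < G], the past values of [x] over
    the lag window are at most [lam * x t] for a [lam] with
    [lam ^ beta < a / b], so [x' <= - eta * g (x t)] with [eta > 0], and this
    beats the term [r / t] of [h'] because [(beta - 1) * r < 1]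
    ([ln_solution_le]).  At a record of [- (ln x + r * ln)] with [G < r], the
    delayed value is at least [lam * x t] with [lam ^ beta > a / b], so
    [0 <= x'], while [ln x + r * ln] would have to be nonincreasing
    ([ln_solution_ge]).  Letting [r] tend to [G] from both sides gives the
    limit.

    Of [g] only three facts are used: it is increasing near zero, it is
    regularly varying with exponent [beta], which follows from the assumption
    on [g'] by l'Hopital's rule ([regularly_varying0_primitive]), and it is at
    least a multiple of [y ^ e] near zero for each [e > beta]
    ([regularly_varying0_ge_powR]). *)

(** * Records *)

Lemma is_derive_lt0_left (R : realType) (h : R -> R) (t d : R) :
  is_derive t 1 h d -> d < 0 -> \forall s \near t^'-, h t < h s.
Proof.
move=> [hd <-] d0.
have := cvgr_lt _ hd _ d0.
move=> [e /= e0 eP]; exists e => //= s /= ste st.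
have := eP (s - t); rewrite /= sub0r normrN distrC => /(_ ste).
rewrite subr_eq0 lt_eqF// => /(_ isT).
rewrite /GRing.scale/= mulr1 subrK nmulr_rlt0 ?subr_gt0//.
by rewrite invr_lt0 subr_lt0.
Qed.

(** If [h] exceeded its values on [[T0, T]], its maximum over a longer interval
    [[T0, t]] would be a record after [T], and a negative derivative there makes
    [h] larger just before it.  Only records with [0 <= h t] have to be examined,
    since the bound can be taken nonnegative. *)
Lemma bounded_of_records (R : realType) (h : R -> R) (T0 T : R) :
  T0 <= T ->
  (forall t, T0 <= t -> {for t, continuous h}) ->
  (forall t, T < t -> 0 <= h t ->
     (forall s, T0 <= s <= t -> h s <= h t) ->
     exists2 d, d < 0 & is_derive t 1 h d) ->
  exists c, forall t, T0 <= t -> h t <= c.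
Proof.
move=> T0T hc rec.
have hcw u v : T0 <= u -> {within `[u, v], continuous h}.
  move=> T0u; apply/continuous_in_subspaceT => z /[1!inE]/=.
  by rewrite in_itv/= => /andP[uz _]; apply: hc; exact: le_trans uz.
have [c0 _ c0max] := EVT_max T0T (hcw _ _ (lexx _)).
exists (Num.max 0 (h c0)) => t T0t; rewrite leNgt; apply/negP.
rewrite gt_max => /andP[ht0 htc0].
have [r /[!in_itv]/= /andP[T0r rt] rmax] := EVT_max T0t (hcw _ _ (lexx _)).
have htr : h t <= h r by apply: rmax; rewrite in_itv/= T0t lexx.
have Tr : T < r.
  rewrite ltNge; apply/negP => rT.
  have := c0max r; rewrite in_itv/= T0r rT => /(_ isT); lra.
have rrec s : T0 <= s <= r -> h s <= h r.
  by move=> /andP[T0s sr]; apply: rmax; rewrite in_itv/= T0s (le_trans sr rt).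
have [d d0 hd] := rec r Tr (le_trans (ltW ht0) htr) rrec.
have [s [hrs /andP[T0s sr]]] : exists s, h r < h s /\ T0 <= s <= r.
  near r^'- => s; exists s; split.
    by near: s; exact: is_derive_lt0_left hd d0.
  apply/andP; split; last exact/ltW.
  by near: s; apply: nbhs_left_ge; exact: le_lt_trans T0T Tr.
by have := rrec s; rewrite T0s sr leNgt hrs => /(_ isT).
Unshelve. all: by end_near. Qed.

(** * Regular variation at zero *)

Lemma near_right0 (R : realType) (P : R -> Prop) :
  (\forall y \near 0^'+, P y) ->
  exists2 y0 : R, 0 < y0 & forall y : R, 0 < y < y0 -> P y.
Proof.
move=> [e /= e0 eP]; exists e => // y /andP[y0 ye]; apply: eP => //=.
by rewrite sub0r normrN gtr0_norm.
Qed.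

(** This half of Karamata's theorem is l'Hopital's rule for the quotient of
    [y |-> g (r * y)] by [g]: the quotient of the derivatives is
    [r * g' (r * y) / g' y], which tends to [r * r ^ (al - 1)]. *)
Lemma regularly_varying0_primitive (R : realType) (g : R -> R) (delta al : R) :
  0 < delta ->
  (forall y : R, 0 < y < delta -> derivable g y 1) ->
  (forall y : R, 0 < y < delta -> 0 < derive1 g y) ->
  (forall y : R, 0 < y -> 0 < g y) ->
  g y @[y --> 0^'+] --> 0 ->
  regularly_varying0 (al - 1) (derive1 g) -> regularly_varying0 al g.
Proof.
move=> d0 dg g'0 gpos g0 [_ rv]; split.
  by near=> y; apply: gpos; near: y; exact: nbhs_right_gt.
move=> r r0.
(* [d] keeps both [y] and [r * y] in the interval where [g] is derivable. *)
pose d := Num.min delta (delta / r).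
have dpos : 0 < d by rewrite lt_min d0 divr_gt0.
have yd y : y \in `]0, d[ -> (0 < y < delta) /\ (0 < r * y < delta).
  rewrite in_itv/= lt_min => /and3P[y0 y1 y2]; rewrite y0 y1 mulr_gt0//=.
  by rewrite mulrC -ltr_pdivlMr.
have der y : 0 < y < delta -> is_derive y 1 g (derive1 g y).
  by move=> yin; apply: DeriveDef; [exact: dg|rewrite derive1E].
apply: (@lhopital_at_right R (fun y => g (r * y)) (fun y => derive1 g (r * y) * r)
  g (derive1 g) 0 d) => //.
- move=> y /yd[_ /der gry].
  have -> : (fun y => g (r * y)) = g \o (fun y => r * y) by [].
  apply: is_derive1_comp.
  by rewrite -[X in is_derive _ _ _ X](mulr1 r); exact: is_deriveZ.
- by move=> y /yd[/der].
- move: g0 => /cvgrPdist_lt g0; apply/cvgrPdist_lt => e e0.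
  have [y0 y0pos y0P] := near_right0 (g0 e e0).
  near=> y; apply: y0P; apply/andP; split.
    by rewrite mulr_gt0//; near: y; exact: nbhs_right_gt.
  rewrite mulrC -ltr_pdivlMr//.
  by near: y; apply: nbhs_right_lt; exact: divr_gt0.
- by move=> y /yd[yin _]; rewrite gt_eqF// g'0.
- have -> : (r `^ al) = r `^ (al - 1) * r.
    rewrite -[X in _ = _ * X](powRr1 (ltW r0)) -powRD ?subrK//.
    by rewrite (gt_eqF r0) implybT.
  under eq_fun do rewrite mulrAC.
  by apply: cvgMl; exact: rv.
Unshelve. all: by end_near. Qed.

(** A lower bound of Potter type.  The ratio [g (y / 2) / g y] tends to
    [2 ^ (- al)], which exceeds [2 ^ (- e)], so the bound at [2 * y] implies the
    bound at [y], and an induction carries it from a dyadic block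
    [[y0 / 2, y0]] down to zero.  Monotonicity is what makes a single constant
    serve the whole first block. *)
Lemma regularly_varying0_ge_powR (R : realType) (g : R -> R) (delta al e : R) :
  0 < delta -> (forall y : R, 0 < y -> 0 < g y) ->
  {in `]0, delta[ &, {homo g : y z / y <= z}} ->
  regularly_varying0 al g -> 0 <= al -> al < e ->
  exists2 K, 0 < K & \forall y \near 0^'+, K * y `^ e <= g y.
Proof.
move=> d0 gpos gle [_ rv] al0 ale.
have half0 : 0 < 2^-1 :> R by rewrite invr_gt0.
have [y1 y1pos y1P] : exists2 y1 : R, 0 < y1 &
    forall y : R, 0 < y < y1 -> y < delta /\ 2^-1 `^ e * g y <= g (2^-1 * y).
  apply: near_right0; near=> y; split.
    by near: y; exact: nbhs_right_lt.
  rewrite -ler_pdivlMr; last by apply: gpos; near: y; exact: nbhs_right_gt.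
  near: y; apply: (cvgr_ge _ (rv _ half0) _).
  rewrite /powR gt_eqF// ltr_expR ltr_nM2r// ln_lt0// half0/=; lra.
pose y0 := y1 / 2.
have y0pos : 0 < y0 by rewrite divr_gt0.
have y01 : y0 < y1 by rewrite /y0; lra.
(* The constant for which the bound holds on the block [[y0 / 2, y0]]. *)
exists (g (y0 / 2) / y0 `^ e); first by rewrite divr_gt0 ?gpos ?divr_gt0// powR_gt0.
set K := _ / _.
have K0 : 0 < K by rewrite divr_gt0 ?gpos ?divr_gt0// powR_gt0.
suff claim n : forall y, y0 * 2^-1 ^+ n.+1 <= y <= y0 -> K * y `^ e <= g y.
  near=> y.
  have ypos : 0 < y by near: y; exact: nbhs_right_gt.
  have yy0 : y <= y0 by near: y; exact: nbhs_right_le.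
  have := @cvg_expr R 2^-1.
  rewrite ger0_norm ?invr_ge0// => /(_ _)/cvgr_lt.
  have : 0 < y / y0 by rewrite divr_gt0.
  have h1 : 2^-1 < 1 :> R by lra.
  move=> yy /(_ h1 _ yy)[N _ NP].
  apply: (claim N); rewrite yy0 andbT mulrC -ler_pdivlMr//.
  by apply/ltW/NP => /=.
elim: n => [|n IH] y /andP[ny yy0].
  have ypos : 0 < y by apply: lt_le_trans ny; rewrite mulr_gt0// exprn_gt0.
  rewrite expr1 in ny.
  apply: (@le_trans _ _ (g (y0 / 2))).
    rewrite /K mulrAC -mulrA ger_pMr; last by rewrite gpos// divr_gt0.
    rewrite ler_pdivrMr ?powR_gt0// mul1r.
    by rewrite ge0_ler_powR ?nnegrE ?(ltW ypos) ?(ltW y0pos)// (le_trans al0 (ltW ale)).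
  have [yd _] : y < delta /\ 2^-1 `^ e * g y <= g (2^-1 * y).
    by apply: y1P; rewrite ypos /=; exact: le_lt_trans y01.
  apply: gle => //; rewrite in_itv/= ?ypos// divr_gt0//=.
  exact: le_lt_trans yd.
have [y2|y2] := lerP (y0 * 2^-1 ^+ n.+1) y; first by apply: IH; rewrite y2.
have y2y0 : 2 * y <= y0.
  have yn : y0 * 2^-1 ^+ n <= y0.
    by rewrite ger_pMr// exprn_ile1//; lra.
  by rewrite exprS mulrCA -ltr_pdivrMl// invrK in y2; exact: le_trans (ltW y2) yn.
have ypos : 0 < y by apply: lt_le_trans ny; rewrite mulr_gt0// exprn_gt0.
have [_ gy] : 2 * y < delta /\ 2^-1 `^ e * g (2 * y) <= g (2^-1 * (2 * y)).
  by apply: y1P; rewrite mulr_gt0//=; exact: le_lt_trans y01.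
rewrite mulKf ?pnatr_eq0// in gy; apply: le_trans gy.
rewrite mulrC -[X in X `^ e](mulKf (_ : 2 != 0)) ?pnatr_eq0//.
rewrite powRM ?mulr_ge0 ?(ltW ypos)// -mulrA ler_wpM2l ?powR_ge0//.
rewrite mulrC; apply: IH; rewrite y2y0 andbT.
by rewrite exprS mulrCA ler_pdivrMl in ny.
Unshelve. all: by end_near. Qed.

(** * Bounds on the logarithm of a solution *)

Lemma near_pinfty_ge (R : realType) (P : R -> Prop) :
  (\forall t \near +oo, P t) -> exists T, forall t, T <= t -> P t.
Proof.
by move=> [M [_ MP]]; exists (M + 1) => t Mt; apply: MP; lra.
Qed.

Lemma cvg_ln_pinfty (R : realType) : (@ln R) t @[t --> +oo] --> +oo.
Proof.
apply/cvgryPge => A; near=> t.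
rewrite -ler_expR lnK; last first.
  by rewrite posrE; near: t; apply: nbhs_pinfty_gt; rewrite num_real.
by near: t; apply: nbhs_pinfty_ge; rewrite num_real.
Unshelve. all: by end_near. Qed.

Lemma is_derive_ln_add_ln (R : realType) (x : R -> R) (r t v : R) :
  0 < t -> 0 < x t -> is_derive t 1 x v ->
  is_derive t 1 (fun s => ln (x s) + r * ln s) (v / x t + r / t).
Proof.
move=> t0 xt0 xv; apply: is_deriveD; last first.
  by apply: is_deriveZ; exact: is_derive1_ln.
rewrite mulrC; apply: (@is_derive1_comp _ (@ln R) x) => //.
exact: is_derive1_ln.
Qed.

Lemma is_derive_continuous (R : realType) (h : R -> R) (t d : R) :
  is_derive t 1 h d -> {for t, continuous h}.
Proof.
by move=> [+ _] => /derivable1_diffP; exact: differentiable_continuous.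
Qed.

Lemma eventually_small (R : realType) (x : R -> R) (y1 : R) :
  0 < y1 -> (forall t, 0 < t -> 0 < x t) -> x t @[t --> +oo] --> 0 ->
  exists2 T0, 1 <= T0 & forall t, T0 <= t -> 0 < x t < y1.
Proof.
move=> y10 xpos x0; have [T TP] := near_pinfty_ge (cvgr_lt _ x0 _ y10).
exists (Num.max 1 T); first by rewrite le_max lexx.
move=> t; rewrite ge_max => /andP[t1 Tt].
by rewrite TP// andbT; apply: xpos; lra.
Qed.

(** The part of the delay equation that governs the behaviour at infinity: no
    history function, and only positive times, where derivatives are
    two-sided. *)
Definition positive_solution (R : realType) (tau g : R -> R) (a b : R)
    (x : R -> R) : Prop :=
  forall t : R, 0 < t -> 0 < x t /\
    exists2 m, is_maximum [set g (x s) | s in `[t - tau t, t]] m &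
               is_derive t 1 x (- a * g (x t) + b * m).

(** Here [l] stands for [ln (1 / (1 - q))] and [r] is below the critical
    exponent.  At a record [t] of [h = ln x + r * ln], each [s] in the lag window
    has [ln x s <= ln x t + r * l'] for a fixed [l' > l], so the maximum in the
    equation is at most [g (lam * x t) <= k * g (x t)] with [lam = exp (r * l')]
    and [b * k < a].  Hence [x' / x <= - eta * g (x t) / x t].  As [0 <= h t]
    bounds [x t] below by [t ^ (- r)], the right-hand side is at most a negative
    multiple of [t ^ (- (e - 1) * r)], and it dominates the other term
    [r / t] of [h'] because [(e - 1) * r < 1]. *)
Lemma ln_solution_le (R : realType) (tau g x : R -> R)
    (delta a b beta l r : R) :
  0 < delta -> (forall y : R, 0 < y -> 0 < g y) ->
  {in `]0, delta[ &, {homo g : y z / y <= z}} ->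
  1 < beta -> regularly_varying0 beta g -> 0 < b -> b < a ->
  positive_solution tau g a b x ->
  x t @[t --> +oo] --> 0 ->
  t - tau t @[t --> +oo] --> +oo ->
  ln t - ln (t - tau t) @[t --> +oo] --> l ->
  0 < r -> (beta - 1) * r < 1 -> beta * r * l < ln (a / b) ->
  exists c, \forall t \near +oo, ln (x t) + r * ln t <= c.
Proof.
move=> d0 gpos gle beta1 grv b0 ba sol x0 lagoo lagl r0 br1 brl.
have a0 : 0 < a by exact: lt_trans ba.
have ab0 : 0 < a / b by rewrite divr_gt0.
(* [l'] is the midpoint between [l] and the value at which [lam ^ beta] would
   reach [a / b]. *)
have [l' ll' brl'] : exists2 l', l < l' & beta * r * l' < ln (a / b).
  have br0 : 0 < beta * r by rewrite mulr_gt0//; lra.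
  exists ((l + ln (a / b) / (beta * r)) / 2).
    have : l < ln (a / b) / (beta * r) by rewrite ltr_pdivlMr// mulrC.
    lra.
  have -> : beta * r * ((l + ln (a / b) / (beta * r)) / 2) =
    (beta * r * l + ln (a / b)) / 2 by field; rewrite gt_eqF//=; lra.
  lra.
pose lam := expR (r * l').
have lam0 : 0 < lam by exact: expR_gt0.
have lamab : lam `^ beta < a / b.
  rewrite /powR gt_eqF// expRK -[ltRHS]lnK ?posrE// ltr_expR.
  by rewrite mulrA.
pose k := (lam `^ beta + a / b) / 2.
have bka : b * k < a.
  by rewrite mulrC -ltr_pdivlMr// /k; lra.
pose eta := a - b * k.
have eta0 : 0 < eta by rewrite subr_gt0.
(* Midpoint of the exponents above [beta] for which still [(e - 1) * r < 1]. *)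
pose e := (beta + 1 + r^-1) / 2.
have rV : beta - 1 < r^-1 by rewrite -[ltRHS]div1r ltr_pdivlMr.
have be : beta < e by rewrite /e; lra.
have e1r : (e - 1) * r < 1.
  have -> : (e - 1) * r = ((beta - 1) * r + 1) / 2.
    by rewrite /e; field; rewrite gt_eqF.
  lra.
have beta0 : 0 <= beta by lra.
have [K K0 KP] := regularly_varying0_ge_powR d0 gpos gle grv beta0 be.
have [y1 y10 y1P] : exists2 y1 : R, 0 < y1 & forall y : R, 0 < y < y1 ->
    [/\ g (lam * y) <= k * g y, lam * y < delta, y < delta & K * y `^ e <= g y].
  apply: near_right0; near=> y; split.
  - rewrite -ler_pdivrMr; last by apply: gpos; near: y; exact: nbhs_right_gt.
    near: y; apply: (cvgr_le _ (grv.2 _ lam0) _).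
    by rewrite /k; lra.
  - rewrite mulrC -ltr_pdivlMr//.
    by near: y; apply: nbhs_right_lt; exact: divr_gt0.
  - by near: y; exact: nbhs_right_lt.
  - by near: y; exact: KP.
have [T0 T01 T0P] := eventually_small y10 (fun t t0 => (sol t t0).1) x0.
have [T T0T TP] : exists2 T, T0 <= T & forall t, T <= t ->
    [/\ T0 <= t - tau t, ln t - ln (t - tau t) <= l' &
        r < eta * K * expR ((1 - (e - 1) * r) * ln t)].
  have lnoo : (1 - (e - 1) * r) * ln t @[t --> +oo] --> +oo.
    by apply: gt0_cvgMry; [rewrite subr_gt0|exact: cvg_ln_pinfty].
  have [T TP] : exists T, forall t, T <= t ->
    [/\ T0 <= t - tau t, ln t - ln (t - tau t) <= l' &
        r < eta * K * expR ((1 - (e - 1) * r) * ln t)].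
    apply: near_pinfty_ge; near=> t; split.
    - by near: t; move/cvgryPge : lagoo; exact.
    - by near: t; exact: (cvgr_le _ lagl _ ll').
    - rewrite mulrC -ltr_pdivrMr ?mulr_gt0//.
      apply: lt_le_trans (expR_ge1Dx _).
      suff : r / (eta * K) <= (1 - (e - 1) * r) * ln t by lra.
      by near: t; move/cvgryPge : lnoo; exact.
  exists (Num.max T0 T); first by rewrite le_max lexx.
  by move=> t; rewrite ge_max => /andP[_ Tt]; exact: TP.
pose h t := ln (x t) + r * ln t.
have [c hc] : exists c, forall t, T0 <= t -> h t <= c.
  apply: (bounded_of_records T0T).
    move=> t T0t; have t0 : 0 < t by lra.
    have [xt0 [m _ xd]] := sol t t0.
    exact: is_derive_continuous (is_derive_ln_add_ln r t0 xt0 xd).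
  move=> t Tt ht0 hrec.
  have t0 : 0 < t by lra.
  have lnt0 : 0 <= ln t by apply: ln_ge0; lra.
  have [xt0 [m [[/= s + gm] _] xd]] := sol t t0.
  rewrite in_itv/= => /andP[tau_s st].
  exists ((- a * g (x t) + b * m) / x t + r / t); last first.
    exact: is_derive_ln_add_ln.
  have [lag1 lag2 tbig] := TP t (ltW Tt).
  have T0s : T0 <= s by exact: le_trans tau_s.
  have s0 : 0 < s by lra.
  have /andP[xs0 xsy1] := T0P s T0s.
  have [gk lamd xtd Kx] : [/\ g (lam * x t) <= k * g (x t), lam * x t < delta,
      x t < delta & K * x t `^ e <= g (x t)].
    by apply: y1P; apply: T0P; lra.
  have [_ _ xsd _] := y1P _ (T0P s T0s).
  have xslam : x s <= lam * x t.
    rewrite -ler_ln ?posrE ?mulr_gt0// lnM ?posrE// expRK.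
    have : h s <= h t by apply: hrec; rewrite T0s.
    rewrite /h => hst.
    have lnts : ln t - ln s <= l'.
      apply: le_trans lag2; rewrite lerD2l lerN2 ler_ln ?posrE//; lra.
    have : r * (ln t - ln s) <= r * l' by rewrite ler_wpM2l// ltW.
    rewrite mulrBr; lra.
  have mk : m <= k * g (x t).
    rewrite -gm; apply: le_trans gk; apply: gle => //.
      by rewrite in_itv/= xs0.
    by rewrite in_itv/= lamd mulr_gt0.
  have num : - a * g (x t) + b * m <= - (eta * K * x t `^ e).
    have : b * m <= b * (k * g (x t)) by rewrite ler_wpM2l// ltW.
    have : eta * (K * x t `^ e) <= eta * g (x t) by rewrite ler_wpM2l// ltW.
    rewrite /eta; nra.
  have xe : expR (- ((e - 1) * r * ln t)) <= x t `^ e / x t.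
    rewrite /powR gt_eqF// -[X in _ / X]lnK ?posrE// -expRN -expRD ler_expR.
    rewrite /h in ht0; nra.
  have -> : r / t = r * expR (- ln t) by rewrite expRN lnK ?posrE.
  have : (- a * g (x t) + b * m) / x t <= - (eta * K * (x t `^ e / x t)).
    by rewrite mulrA -mulNr ler_pM2r ?invr_gt0.
  have : eta * K * expR (- ((e - 1) * r * ln t)) <= eta * K * (x t `^ e / x t).
    by rewrite ler_wpM2l// mulr_ge0 ?ltW.
  have : r * expR (- ln t) < eta * K * expR (- ((e - 1) * r * ln t)).
    have -> : - ((e - 1) * r * ln t) = (1 - (e - 1) * r) * ln t + - ln t by ring.
    by rewrite expRD mulrA ltr_pM2r ?expR_gt0.
  lra.
exists c; near=> t; apply: hc.
by near: t; apply: nbhs_pinfty_ge; rewrite num_real.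
Unshelve. all: by end_near. Qed.

(** The mirror image of [ln_solution_le], with [r] above the critical exponent.
    At a record of [- (ln x + r * ln)] the delayed value alone satisfies
    [a * g (x t) <= b * g (x (t - tau t))], so that [0 <= x'] there, and
    [- (x' / x + r / t)] is negative whatever the size of [x']. *)
Lemma ln_solution_ge (R : realType) (tau g x : R -> R)
    (delta a b beta l r : R) :
  0 < delta -> (forall y : R, 0 < y -> 0 < g y) ->
  {in `]0, delta[ &, {homo g : y z / y <= z}} ->
  0 < beta -> regularly_varying0 beta g -> 0 < b -> b < a ->
  positive_solution tau g a b x ->
  x t @[t --> +oo] --> 0 ->
  t - tau t @[t --> +oo] --> +oo ->
  ln t - ln (t - tau t) @[t --> +oo] --> l -> 0 < r ->
  ln (a / b) < beta * r * l ->
  exists c, \forall t \near +oo, - c <= ln (x t) + r * ln t.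
Proof.
move=> d0 gpos gle beta0 grv b0 ba sol x0 lagoo lagl r0 brl.
have a0 : 0 < a by exact: lt_trans ba.
have ab0 : 0 < a / b by rewrite divr_gt0.
have lnab0 : 0 < ln (a / b) by rewrite ln_gt0// ltr_pdivlMr// mul1r.
have br0 : 0 < beta * r by rewrite mulr_gt0.
have [l' [l'0 l'l brl']] : exists l', [/\ 0 < l', l' < l & ln (a / b) < beta * r * l'].
  have q0 : 0 < ln (a / b) / (beta * r) by rewrite divr_gt0.
  have ql : ln (a / b) / (beta * r) < l by rewrite ltr_pdivrMr// [l * _]mulrC.
  exists ((l + ln (a / b) / (beta * r)) / 2); split; [lra|lra|].
  have -> : beta * r * ((l + ln (a / b) / (beta * r)) / 2) =
    (beta * r * l + ln (a / b)) / 2 by field; rewrite gt_eqF//= gt_eqF.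
  by lra.
pose lam := expR (r * l').
have lam0 : 0 < lam by exact: expR_gt0.
have lamab : a / b < lam `^ beta.
  rewrite /powR gt_eqF// expRK -[ltLHS]lnK ?posrE// ltr_expR.
  by rewrite mulrA.
have [y1 y10 y1P] : exists2 y1 : R, 0 < y1 & forall y : R, 0 < y < y1 ->
    y < delta /\ a / b * g y <= g (lam * y).
  apply: near_right0; near=> y; split.
    by near: y; exact: nbhs_right_lt.
  rewrite -ler_pdivlMr; last by apply: gpos; near: y; exact: nbhs_right_gt.
  by near: y; apply: (cvgr_ge _ (grv.2 _ lam0) _).
have [T0 T01 T0P] := eventually_small y10 (fun t t0 => (sol t t0).1) x0.
have [T T0T TP] : exists2 T, T0 <= T & forall t, T <= t ->
    T0 <= t - tau t /\ l' <= ln t - ln (t - tau t).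
  have [T TP] : exists T, forall t, T <= t ->
      T0 <= t - tau t /\ l' <= ln t - ln (t - tau t).
    apply: near_pinfty_ge; near=> t; split.
    - by near: t; move/cvgryPge : lagoo; exact.
    - by near: t; exact: (cvgr_ge _ lagl _ l'l).
  exists (Num.max T0 T); first by rewrite le_max lexx.
  by move=> t; rewrite ge_max => /andP[_ Tt]; exact: TP.
pose h t := - (ln (x t) + r * ln t).
have [c hc] : exists c, forall t, T0 <= t -> h t <= c.
  apply: (bounded_of_records T0T).
    move=> t T0t; have t0 : 0 < t by lra.
    have [xt0 [m _ xd]] := sol t t0.
    by apply: is_derive_continuous (is_deriveN (is_derive_ln_add_ln r t0 xt0 xd)).
  move=> t Tt _ hrec.
  have t0 : 0 < t by lra.
  have [xt0 [m [_ mub] xd]] := sol t t0.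
  exists (- ((- a * g (x t) + b * m) / x t + r / t)); last first.
    by apply: is_deriveN; exact: is_derive_ln_add_ln.
  have [] := TP t (ltW Tt); set s := t - tau t => T0s lag.
  have s0 : 0 < s by lra.
  have st : s <= t by rewrite -ler_ln ?posrE//; lra.
  have /andP[xs0 xsy1] := T0P s T0s.
  have [xsd _] := y1P _ (T0P s T0s).
  have [xtd kg] : x t < delta /\ a / b * g (x t) <= g (lam * x t).
    by apply: y1P; apply: T0P; lra.
  have xslam : lam * x t <= x s.
    rewrite -ler_ln ?posrE ?mulr_gt0// lnM ?posrE// expRK.
    have : h s <= h t by apply: hrec; rewrite T0s.
    rewrite /h => hst.
    have : r * l' <= r * (ln t - ln s) by rewrite ler_wpM2l// ltW.
    rewrite mulrBr; lra.
  have num : 0 <= - a * g (x t) + b * m.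
    have : g (x s) <= m by apply: mub; exists s => //=; rewrite in_itv/= lexx st.
    have : g (lam * x t) <= g (x s).
      apply: gle => //; rewrite in_itv/= ?xs0// mulr_gt0//=.
      exact: le_lt_trans xsd.
    move=> h1 h2; have := le_trans kg (le_trans h1 h2).
    by rewrite mulrAC ler_pdivrMr//; lra.
  by rewrite oppr_lt0 ltr_wpDl ?divr_ge0 ?divr_gt0// ltW.
exists c; near=> t; rewrite lerNl; apply: hc.
by near: t; apply: nbhs_pinfty_ge; rewrite num_real.
Unshelve. all: by end_near. Qed.

(** * The limit *)

Lemma cvg_ln_lag (R : realType) (tau : R -> R) (q : R) : q < 1 ->
  tau t / t @[t --> +oo] --> q -> t - tau t @[t --> +oo] --> +oo ->
  ln t - ln (t - tau t) @[t --> +oo] --> ln (1 / (1 - q)).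
Proof.
move=> q1 tauq lagoo.
have q0 : 0 < 1 - q by rewrite subr_gt0.
rewrite div1r lnV ?posrE//.
suff : - ln (1 - tau t / t) @[t --> +oo] --> - ln (1 - q).
  apply: cvg_trans; apply: near_eq_cvg; near=> t.
  have t0 : 0 < t by near: t; apply: nbhs_pinfty_gt; rewrite num_real.
  have st0 : 0 < t - tau t by near: t; move/cvgryPgt : lagoo; exact.
  have -> : 1 - tau t / t = (t - tau t) / t by field; rewrite gt_eqF.
  by rewrite ln_div ?posrE// opprB.
apply: cvgN; apply: (continuous_cvg _ (continuous_ln q0)).
by apply: cvgB => //; exact: cvg_cst.
Unshelve. all: by end_near. Qed.

Lemma cvg_ln_ratio (R : realType) (x : R -> R) (G : R) :
  0 < G ->
  (forall r, 0 < r < G -> exists c, \forall t \near +oo, ln (x t) + r * ln t <= c) ->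
  (forall r, G < r -> exists c, \forall t \near +oo, - c <= ln (x t) + r * ln t) ->
  ln (x t) / ln t @[t --> +oo] --> - G.
Proof.
move=> G0 ub lb; apply/cvgrPdist_le => e e0.
(* The second argument keeps [r1] positive when [e] is large. *)
pose r1 := Num.max (G - e / 2) (G / 2).
have [c1 c1P] : exists c, \forall t \near +oo, ln (x t) + r1 * ln t <= c.
  apply: ub; rewrite /r1 lt_max gt_max.
  by apply/andP; split; [apply/orP; right|apply/andP; split]; lra.
have [c2 c2P] : exists c, \forall t \near +oo, - c <= ln (x t) + (G + e / 2) * ln t.
  by apply: lb; lra.
have lnoo := @cvg_ln_pinfty R.
near=> t.
have lt1 : 1 <= ln t by near: t; move/cvgryPge : lnoo; exact.
have lt0 : 0 < ln t by lra.
have r1G : G - e / 2 <= r1 by rewrite le_max lexx.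
have /ler_normlP [h1 h2] : `|ln (x t) / ln t + G| <= e.
  have -> : ln (x t) / ln t + G = (ln (x t) + G * ln t) / ln t.
    by field; rewrite gt_eqF.
  rewrite normrM normfV (gtr0_norm lt0) ler_pdivrMr// ler_norml.
  have b1 : ln (x t) + r1 * ln t <= c1 by near: t.
  have b2 : - c2 <= ln (x t) + (G + e / 2) * ln t by near: t.
  have e1 : c1 / (e / 2) <= ln t by near: t; move/cvgryPge : lnoo; exact.
  have e2 : c2 / (e / 2) <= ln t by near: t; move/cvgryPge : lnoo; exact.
  rewrite ler_pdivrMr ?divr_gt0// in e1; rewrite ler_pdivrMr ?divr_gt0// in e2.
  have : (G - e / 2) * ln t <= r1 * ln t by rewrite ler_pM2r.
  by move=> e3; apply/andP; split; lra.
by rewrite -opprD normrN addrC; apply/ler_normlP; split; lra.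
Unshelve. all: by end_near. Qed.

Theorem theorem23 (R : realType)
  (tau g psi x : R -> R) (taubar q delta1 beta a b : R)
  (tau_ge0 : forall t : R, 0 <= t -> 0 <= tau t)
  (tau_cont : {within `[0, +oo[, continuous tau})
  (tau_lag : t - tau t @[t --> +oo] --> +oo)
  (taubarE : - taubar = inf [set t - tau t | t in `[0, +oo[])
  (q_gt0 : 0 < q) (q_lt1 : q < 1)
  (tau_lim : tau t / t @[t --> +oo] --> q)
  (g_ge0 : forall y : R, 0 <= y -> 0 <= g y)
  (g_cont : {within `[0, +oo[, continuous g})
  (g0 : g 0 = 0)
  (g_gt0 : forall y : R, 0 < y -> 0 < g y)
  (delta1_gt0 : 0 < delta1)
  (g_derivable : forall y : R, 0 < y < delta1 -> derivable g y 1)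
  (g'_cont : {within `]0, delta1[, continuous (derive1 g)})
  (g'_gt0 : forall y : R, 0 < y < delta1 -> 0 < (derive1 g) y)
  (beta_gt1 : 1 < beta)
  (g'_rv : regularly_varying0 (beta - 1) (derive1 g))
  (b_gt0 : 0 < b) (ab : b < a)
  (a_lt : a < b * (1 / (1 - q)) `^ (beta / (beta - 1)))
  (psi_cont : {within `[- taubar, 0], continuous psi})
  (psi_gt0 : forall t : R, - taubar <= t <= 0 -> 0 < psi t)
  (x_sol : is_solution tau g a b taubar psi x)
  (x_lim : x t @[t --> +oo] --> 0) :
  ln (x t) / ln t @[t --> +oo] -->
    - (1 / beta) * (1 / ln (1 / (1 - q))) * ln (a / b).
Proof.
have [_ x_gt0 x_eq _] := x_sol.
(* For a set without lower bound the infimum has the default value 0, which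
   still gives the inequality. *)
have taubar0 : - taubar <= 0.
  rewrite taubarE; set S := [set _ | _ in _].
  have [Sinf|/inf_out ->//] := pselect (has_inf S).
  apply: (@le_trans _ _ (0 - tau 0)).
    by apply: (ge_inf Sinf.2); exists 0 => //=; rewrite in_itv/= lexx.
  by rewrite sub0r oppr_le0 tau_ge0.
have sol : positive_solution tau g a b x.
  move=> t t0; split; first by apply: x_gt0; exact: le_trans (ltW t0).
  by have [m mmax [/(_ t0) xd _]] := x_eq t (ltW t0); exists m.
have g_lim : g y @[y --> 0^'+] --> 0.
  by have [_] := (continuous_within_itvcyP 0 g).1 g_cont; rewrite g0.
have g_rv : regularly_varying0 beta g.
  exact: (regularly_varying0_primitive delta1_gt0 g_derivable g'_gt0 g_gt0 g_lim g'_rv).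
have g_mono : {in `]0, delta1[ &, {homo g : y z / y <= z}}.
  have gc : {in `]0, delta1[%classic, continuous g}.
    move=> y; rewrite inE/= in_itv/= => /g_derivable /derivable1_diffP.
    exact: differentiable_continuous.
  move=> y z yd zd; rewrite le_eqVlt => /predU1P[->//|yz].
  have dg w : w \in `]0, delta1[%R -> derivable g w 1.
    by rewrite in_itv; exact: g_derivable.
  have dg_gt0 w : w \in `]0, delta1[%R -> 0 < derive1 g w.
    by rewrite in_itv; exact: g'_gt0.
  exact/ltW/(gtr0_derive1_lt_oo dg dg_gt0 gc yd zd yz).
set l := ln (1 / (1 - q)).
have iq1 : 1 < 1 / (1 - q) by rewrite ltr_pdivlMr; lra.
have l0 : 0 < l by exact: ln_gt0.
have L0 : 0 < ln (a / b) by rewrite ln_gt0// ltr_pdivlMr// mul1r.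
have a0 : 0 < a by exact: lt_trans ab.
have beta0 : 0 < beta by lra.
have lag := cvg_ln_lag q_lt1 tau_lim tau_lag.
pose G := ln (a / b) / (beta * l).
have bl0 : 0 < beta * l by rewrite mulr_gt0.
have G0 : 0 < G by rewrite divr_gt0.
(* The bound on [a / b], rewritten as a bound on the exponent [G]. *)
have bG1 : (beta - 1) * G < 1.
  have : ln (a / b) < ln ((1 / (1 - q)) `^ (beta / (beta - 1))).
    by rewrite ltr_ln ?posrE ?divr_gt0// ?powR_gt0 ?ltr_pdivrMr// 1?mulrC//; lra.
  rewrite ln_powR -/l mulrAC ltr_pdivlMr ?subr_gt0// => h.
  by rewrite /G mulrA ltr_pdivrMr// mul1r mulrC.
have -> : - (1 / beta) * (1 / l) * ln (a / b) = - G.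
  by rewrite /G; field; rewrite !gt_eqF.
apply: cvg_ln_ratio => // r.
  move=> /andP[r0 rG].
  apply: (ln_solution_le delta1_gt0 _ _ _ g_rv _ _ sol x_lim tau_lag lag) => //.
    by apply: le_lt_trans bG1; rewrite ler_pM2l ?subr_gt0// ltW.
  by rewrite mulrAC [_ * r]mulrC -ltr_pdivlMr.
move=> Gr.
apply: (ln_solution_ge delta1_gt0 _ _ _ g_rv _ _ sol x_lim tau_lag lag) => //.
  exact: lt_trans Gr.
by rewrite mulrAC [_ * r]mulrC -ltr_pdivrMr.
Qed.
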